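(* For $m=1,2$ let $L_m:\mathbb{R}^4\to\mathbb{R}$ be linear functionals such that $\{\xi_1-\xi_2+\xi_3-\xi_4,L_1,L_2\}$ is linearly independent. Then there is $C<\infty$ such that for all nonnegative measurable $g_1,\dots,g_4\in L^2(\mathbb{R})$ and all measurable $E_1,E_2\subset\mathbb{R}$, \[ \int_\Xi\prod_{n=1}^4g_n(\xi_n)\prod_{m=1}^2\chi_{E_m}(L_m(\vec\xi))\,d\lambda(\vec\xi)\le C\prod_{m=1}^2|E_m|^{1/2}\prod_{n=1}^4\|g_n\|_{L^2}. \]
   Context: $\Xi=\{\vec\xi\in\mathbb{R}^4:\xi_1-\xi_2+\xi_3-\xi_4=0\}$ and $\lambda$ is (appropriately normalized) Lebesgue measure on $\Xi$; $\xi_1-\xi_2+\xi_3-\xi_4$ denotes the corresponding linear functional on $\mathbb{R}^4$. $\chi_E$ is the indicator of $E$. *)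

(* Defs.v *)
From HB Require Import structures.
From mathcomp Require Import all_boot all_order all_algebra.
From mathcomp Require Import all_classical all_reals all_analysis.
Set Implicit Arguments. Unset Strict Implicit. Unset Printing Implicit Defensive.
Import Order.TTheory GRing.Theory Num.Theory.
Local Open Scope ring_scope.

Definition lfun4 {R : realType} (L : 'I_4 -> R) (xi : 'I_4 -> R) : R :=
  \sum_(i < 4) L i * xi i.

Definition alt4 {R : realType} : 'I_4 -> R :=
  fun i => if odd (val i) then -1 else 1.

Definition lin_indep3 {R : realType} (f0 f1 f2 : 'I_4 -> R) : Prop :=
  forall c0 c1 c2 : R,
    (forall xi : 'I_4 -> R,
        c0 * lfun4 f0 xi + c1 * lfun4 f1 xi + c2 * lfun4 f2 xi = 0) ->
    [/\ c0 = 0, c1 = 0 & c2 = 0].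

(* The point of Xi = {xi_1 - xi_2 + xi_3 - xi_4 = 0} parametrized by
   (xi_1, xi_2, xi_3); then xi_4 = xi_1 - xi_2 + xi_3. *)
Definition xi_of {R : realType} (p : (R * R) * R) : 'I_4 -> R :=
  fun i => match val i with
           | 0 => p.1.1
           | 1 => p.1.2
           | 2 => p.2
           | _ => p.1.1 - p.1.2 + p.2
           end.

(* Lebesgue measure on Xi (normalized via the parametrization above):
   the product Lebesgue measure on R^3. *)
Definition lambdaXi {R : realType} :=
  ((@lebesgue_measure R \x @lebesgue_measure R) \x @lebesgue_measure R)%E.

(* Main.v *)
(* Parametrize Xi by (xi_1, xi_2, xi_3).  The six factors of the integrand
   become functions of six linear forms on R^3: the coordinates, the form
   xi_1 - xi_2 + xi_3 giving xi_4, and the restrictions l_1, l_2 of L_1, L_2.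
   Independence of {xi_1 - xi_2 + xi_3 - xi_4, L_1, L_2} makes l_1, l_2
   independent, so for some k <= 3 the forms xi_k, l_1, l_2 are a basis of the
   dual of R^3; the remaining forms xi_i, xi_j, xi_4 always are.  Cauchy-Schwarz
   splits the integrand along these two triples, and a linear change of
   variables gives
     || f_1(u.p) f_2(v.p) f_3(w.p) ||_2 = |det(u, v, w)|^(-1/2) prod_i ||f_i||_2,
   while ||chi_E||_2 = |E|^(1/2). *)

Require Import Defs.
From HB Require Import structures.
From mathcomp Require Import all_boot all_order all_algebra.
From mathcomp Require Import all_classical all_reals all_analysis.
From mathcomp Require Import measurable_realfun ssrAC ring lra.
Import Order.TTheory GRing.Theory Num.Theory.
Set Implicit Arguments. Unset Strict Implicit. Unset Printing Implicit Defensive.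
Local Open Scope classical_set_scope.
Local Open Scope ring_scope.

Section affine_change_of_variables.
Context {R : realType}.
Local Notation mu := (@lebesgue_measure R).
Local Notation RR := (measurableTypeR R).
Local Notation affine a b := (fun x : RR => (a * x + b)%R : RR).

Lemma measurable_affine (a b : R) :
  measurable_fun [set: RR] (affine a b).
Proof. by apply: measurable_funD => //; apply: measurable_funM. Qed.

Lemma lebesgue_measure_affine (a b : R) (A : set RR) : 0 < a -> measurable A ->
  (pushforward mu (affine a b) A = (a^-1)%:E * mu A)%E.
Proof.
move=> a0 mA; have a_ge0 : 0 <= a by exact: ltW.
(* The measure structure of [pushforward] depends on a measurability proof. *)
rewrite (@lebesgue_measure_unique R
  (mscale (NngNum a_ge0) (pushforward mu (affine a b)))) //=;
  [exact: measurable_affine|move=> maff|move=> maff].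
  by rewrite /mscale /= muleA -EFinM mulVf ?gt_eqF // mul1e.
move=> _ [[c d] _ <-]; rewrite /mscale /= /pushforward.
have -> : (affine a b) @^-1` `]c, d]%classic =
          `](c - b) / a, (d - b) / a]%classic.
  apply/seteqP; split => x /=; rewrite !in_itv /= ltr_pdivrMr // ler_pdivlMr //.
    by move=> /andP[? ?]; apply/andP; split; rewrite ?ltrBlDr ?lerBrDr mulrC.
  by move=> /andP[? ?]; apply/andP; split; rewrite -?ltrBlDr -?lerBrDr mulrC.
rewrite !lebesgue_measure_itv /= !lte_fin ltr_pM2r ?invr_gt0 // ltrD2r.
case: ifP => _; last by rewrite mule0.
by rewrite -!EFinB -EFinM; congr EFin; field; rewrite gt_eqF.
Qed.

Lemma ge0_integral_oppr (f : R -> \bar R) : measurable_fun setT f ->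
  (forall x, 0 <= f x)%E -> (\int[mu]_x f (- x)%R = \int[mu]_x f x)%E.
Proof.
move=> mf f0.
have := @ge0_integral_pushforward _ _ _ _ _ (-%R : RR -> RR)
  (@oppr_measurable R setT) mu setT f measurableT mf (fun y _ => f0 y).
rewrite preimage_setT => <-.
by apply: eq_measure_integral => /= A mA _; exact: lebesgue_measureN.
Qed.

Let ge0_integral_affine_gt0 (a b : R) (f : R -> \bar R) : 0 < a ->
  measurable_fun setT f -> (forall x, 0 <= f x)%E ->
  (\int[mu]_x f (a * x + b)%R = (a^-1)%:E * \int[mu]_x f x)%E.
Proof.
move=> a0 mf f0.
have := @ge0_integral_pushforward _ _ _ _ _ (affine a b)
  (measurable_affine a b) mu setT f measurableT mf (fun y _ => f0 y).
rewrite preimage_setT => <-.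
have a_ge0 : 0 <= a^-1 by rewrite invr_ge0 ltW.
have -> : a^-1 = (NngNum a_ge0)%:num by [].
rewrite -ge0_integral_mscale //.
apply: eq_measure_integral => [|maff A mA _]; first exact: measurable_affine.
exact: lebesgue_measure_affine.
Qed.

Lemma ge0_integral_affine (a b : R) (f : R -> \bar R) : a != 0 ->
  measurable_fun setT f -> (forall x, 0 <= f x)%E ->
  (\int[mu]_x f (a * x + b)%R = (`|a|^-1)%:E * \int[mu]_x f x)%E.
Proof.
move=> a0 mf f0; have [a_gt0|a_le0] := ltP 0 a.
  by rewrite gtr0_norm // ge0_integral_affine_gt0.
have a_lt0 : a < 0 by rewrite lt_neqAle a0.
transitivity (\int[mu]_x (fun y => f (- y)%R) ((- a) * x + (- b))%R)%E.
  by apply: eq_integral => x _ /=; congr f; ring.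
rewrite ltr0_norm // (@ge0_integral_affine_gt0 _ _ (fun y => f (- y)%R)) ?oppr_gt0 //.
- by rewrite ge0_integral_oppr.
- exact: measurableT_comp mf (@oppr_measurable R setT).
Qed.

End affine_change_of_variables.

Section linear_change_of_variables_plane.
Context {R : realType}.
Local Notation mu := (@lebesgue_measure R).
Local Notation RR := (measurableTypeR R).

Lemma measurable_lin2 (a b s : R) :
  measurable_fun [set: RR * RR] (fun q => (a * q.1 + b * q.2 + s)%R : RR).
Proof.
by apply: measurable_funD => //; apply: measurable_funD; apply: measurable_funM.
Qed.

Let ge0_integral_lin2_c1 (f g : R -> \bar R) (b1 c1 s1 b2 c2 s2 : R) :
  c1 != 0 -> b1 * c2 - b2 * c1 != 0 ->
  measurable_fun setT f -> measurable_fun setT g ->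
  (forall x, 0 <= f x)%E -> (forall x, 0 <= g x)%E ->
  (\int[mu \x mu]_q (f (b1 * q.1 + c1 * q.2 + s1)%R * g (b2 * q.1 + c2 * q.2 + s2)%R)
   = (`|b1 * c2 - b2 * c1|^-1)%:E * (\int[mu]_x f x * \int[mu]_x g x))%E.
Proof.
move=> c10 D0 mf mg f0 g0.
set c := b2 - c2 * b1 / c1.
have DE : b1 * c2 - b2 * c1 = - (c * c1) by rewrite /c; field.
have c0 : c != 0 by move: D0; rewrite DE oppr_eq0 mulf_eq0 negb_or => /andP[].
pose K (q : RR * RR) := (f q.2 * g (c * q.1 + (c2 * (q.2 - s1) / c1 + s2))%R)%E.
have mK : measurable_fun setT K.
  apply: emeasurable_funM; first exact: measurableT_comp mf measurable_snd.
  apply: measurableT_comp mg _.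
  have -> : (fun q : RR * RR => c * q.1 + (c2 * (q.2 - s1) / c1 + s2)) =
            (fun q => c * q.1 + c2 / c1 * q.2 + (s2 - c2 * s1 / c1)).
    by apply/funext => q; field.
  exact: measurable_lin2.
have K0 q : (0 <= K q)%E by rewrite mule_ge0.
rewrite fubini_tonelli1 /=; last 2 first.
- by apply: emeasurable_funM; apply: measurableT_comp (measurable_lin2 _ _ _).
- by move=> q; rewrite mule_ge0.
transitivity (\int[mu]_x ((`|c1|^-1)%:E * \int[mu]_w K (x, w)))%E.
  apply: eq_integral => x _; rewrite /fubini_F /=.
  rewrite -(@ge0_integral_affine _ c1 (b1 * x + s1) (fun w => K (x, w))) //; last first.
    exact: measurable_fun_pair2 x mK.
  by apply: eq_integral => y _; rewrite /K /=; congr (f _ * g _)%E; rewrite /c; field.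
rewrite ge0_integralZl //; last 2 first.
- exact: measurable_fun_fubini_tonelli_F.
- by move=> x _; apply: integral_ge0.
rewrite (fubini_tonelli _ mK K0) /fubini_G /=.
transitivity ((`|c1|^-1)%:E *
              \int[mu]_w (f w * ((`|c|^-1)%:E * \int[mu]_x g x)))%E.
  congr (_ * _)%E; apply: eq_integral => w _; rewrite /K /= ge0_integralZl //.
  - by rewrite ge0_integral_affine.
  - exact: measurableT_comp mg (measurable_affine _ _).
rewrite ge0_integralZr //; last by rewrite mule_ge0 // integral_ge0.
by rewrite (muleCA (\int[mu]_x f x)%E) !muleA -EFinM DE normrN normrM invfM mulrC.
Qed.

Lemma ge0_integral_lin2 (f g : R -> \bar R) (b1 c1 s1 b2 c2 s2 : R) :
  b1 * c2 - b2 * c1 != 0 ->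
  measurable_fun setT f -> measurable_fun setT g ->
  (forall x, 0 <= f x)%E -> (forall x, 0 <= g x)%E ->
  (\int[mu \x mu]_q (f (b1 * q.1 + c1 * q.2 + s1)%R * g (b2 * q.1 + c2 * q.2 + s2)%R)
   = (`|b1 * c2 - b2 * c1|^-1)%:E * (\int[mu]_x f x * \int[mu]_x g x))%E.
Proof.
move=> D0 mf mg f0 g0; have [c10|c10] := eqVneq c1 0; last exact: ge0_integral_lin2_c1.
have c20 : c2 != 0 by move: D0; rewrite c10 mulr0 subr0 mulf_eq0 negb_or => /andP[].
under eq_integral do rewrite muleC.
rewrite ge0_integral_lin2_c1 //; last by rewrite -opprB oppr_eq0.
by rewrite (muleC (\int[mu]_x g x)%E) -opprB normrN.
Qed.

End linear_change_of_variables_plane.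

(* The library's sigma-finite instance on [m1 \x m2] is shadowed by the one
   for products of subprobabilities (both are keyed on [product_measure1]), so
   it is attached to this alias instead; Fubini on [lambdaXi] goes through it. *)
Section sigma_finite_product.
Context d1 d2 (T1 : measurableType d1) (T2 : measurableType d2) (R : realType).
Variables (m1 : {sigma_finite_measure set T1 -> \bar R})
          (m2 : {sigma_finite_measure set T2 -> \bar R}).

Definition sigma_finite_product := (m1 \x m2)%E.

HB.instance Definition _ := Measure.copy sigma_finite_product (m1 \x m2)%E.

Let sigma_finite_product_sigma_finite : sigma_finite setT sigma_finite_product.
Proof.
have /sigma_finiteP[F [TF ndF Foo]] := sigma_finiteT m1.
have /sigma_finiteP[G [TG ndG Goo]] := sigma_finiteT m2.
exists (fun n => F n `*` G n).
  rewrite -setXTT TF TG predeqE => -[x y]; split.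
    move=> [/= [n _ Fnx] [k _ Gky]]; exists (maxn n k) => //; split.
    - by move: x Fnx; exact/subsetPset/ndF/leq_maxl.
    - by move: y Gky; exact/subsetPset/ndG/leq_maxr.
  by move=> [n _ []/= ? ?]; split; exists n.
move=> k; have [? ?] := Foo k; have [? ?] := Goo k.
split; first exact: measurableX.
by rewrite /sigma_finite_product product_measure1E // lte_mul_pinfty // ge0_fin_numE.
Qed.

HB.instance Definition _ := Measure_isSigmaFinite.Build _ _ _
  sigma_finite_product sigma_finite_product_sigma_finite.

End sigma_finite_product.

Definition dot3 {R : pzRingType} (u p : R * R * R) : R :=
  u.1.1 * p.1.1 + u.1.2 * p.1.2 + u.2 * p.2.

Definition det3 {R : pzRingType} (u v w : R * R * R) : R :=
  u.1.1 * (v.1.2 * w.2 - v.2 * w.1.2) - u.1.2 * (v.1.1 * w.2 - v.2 * w.1.1)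
  + u.2 * (v.1.1 * w.1.2 - v.1.2 * w.1.1).

Section linear_change_of_variables_space.
Context {R : realType}.
Local Notation mu := (@lebesgue_measure R).
Local Notation RR := (measurableTypeR R).

Lemma measurable_dot3 (u : R * R * R) :
  measurable_fun [set: RR * RR * RR] (fun p => dot3 u p : RR).
Proof.
apply: measurable_funD; last by apply: measurable_funM => //; exact: measurable_snd.
apply: measurable_funD; apply: measurable_funM => //.
- exact: measurableT_comp measurable_fst measurable_fst.
- exact: measurableT_comp measurable_snd measurable_fst.
Qed.

Let ge0_integral_lin3_u3 (f1 f2 f3 : R -> \bar R) (u v w : R * R * R) :
  u.2 != 0 -> det3 u v w != 0 ->
  measurable_fun setT f1 -> measurable_fun setT f2 -> measurable_fun setT f3 ->
  (forall x, 0 <= f1 x)%E -> (forall x, 0 <= f2 x)%E -> (forall x, 0 <= f3 x)%E ->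
  (\int[lambdaXi]_p (f1 (dot3 u p) * f2 (dot3 v p) * f3 (dot3 w p))
   = (`|det3 u v w|^-1)%:E *
     (\int[mu]_x f1 x * (\int[mu]_x f2 x * \int[mu]_x f3 x)))%E.
Proof.
case: u v w => [[u1 u2] u3] [[v1 v2] v3] [[w1 w2] w3] /= u30 D0.
move=> mf1 mf2 mf3 f10 f20 f30.
set b1 := v1 - v3 * u1 / u3; set c1 := v2 - v3 * u2 / u3; set e1 := v3 / u3.
set b2 := w1 - w3 * u1 / u3; set c2 := w2 - w3 * u2 / u3; set e2 := w3 / u3.
have DE : det3 (u1, u2, u3) (v1, v2, v3) (w1, w2, w3) = u3 * (b1 * c2 - b2 * c1).
  by rewrite /det3 /b1 /c1 /b2 /c2 /=; field.
have D20 : b1 * c2 - b2 * c1 != 0.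
  by move: D0; rewrite DE mulf_eq0 negb_or => /andP[].
pose H (p : RR * RR * RR) := (f1 p.2 *
  (f2 (b1 * p.1.1 + c1 * p.1.2 + e1 * p.2)%R *
   f3 (b2 * p.1.1 + c2 * p.1.2 + e2 * p.2)%R))%E.
have mH : measurable_fun setT H.
  apply: emeasurable_funM; first exact: measurableT_comp mf1 measurable_snd.
  by apply: emeasurable_funM; apply: measurableT_comp (measurable_dot3 (_, _, _)).
have H0 p : (0 <= H p)%E by rewrite !mule_ge0.
rewrite [LHS](@fubini_tonelli1 _ _ _ _ _ (sigma_finite_product mu mu)) /=; last 2 first.
- by apply: emeasurable_funM; [apply: emeasurable_funM|];
    apply: measurableT_comp (measurable_dot3 _).
- by move=> p; rewrite !mule_ge0.
transitivity (\int[sigma_finite_product mu mu]_q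
                ((`|u3|^-1)%:E * \int[mu]_t H (q, t)))%E.
  apply: eq_integral => q _; rewrite /fubini_F /=.
  rewrite -(@ge0_integral_affine _ u3 (u1 * q.1 + u2 * q.2) (fun t => H (q, t))) //;
    last exact: measurable_fun_pair2 q mH.
  apply: eq_integral => t _; rewrite /H /dot3 /= -muleA.
  by congr (f1 _ * (f2 _ * f3 _))%E; rewrite /b1 /c1 /e1 /b2 /c2 /e2; field.
rewrite ge0_integralZl //; last 2 first.
- exact: measurable_fun_fubini_tonelli_F.
- by move=> q _; apply: integral_ge0.
rewrite (fubini_tonelli _ mH H0) /fubini_G /=.
transitivity ((`|u3|^-1)%:E * \int[mu]_t (f1 t * ((`|b1 * c2 - b2 * c1|^-1)%:E *
   (\int[mu]_x f2 x * \int[mu]_x f3 x))))%E.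
  congr (_ * _)%E; apply: eq_integral => t _; rewrite /H /= ge0_integralZl //.
  - by rewrite ge0_integral_lin2.
  - by apply: emeasurable_funM; apply: measurableT_comp (measurable_lin2 _ _ _).
  - by move=> q _; rewrite mule_ge0.
rewrite ge0_integralZr //; last by rewrite !mule_ge0 // integral_ge0.
by rewrite (muleCA (\int[mu]_x f1 x)%E) !muleA -EFinM -invfM -normrM -DE.
Qed.

Lemma ge0_integral_lin3 (f1 f2 f3 : R -> \bar R) (u v w : R * R * R) :
  det3 u v w != 0 ->
  measurable_fun setT f1 -> measurable_fun setT f2 -> measurable_fun setT f3 ->
  (forall x, 0 <= f1 x)%E -> (forall x, 0 <= f2 x)%E -> (forall x, 0 <= f3 x)%E ->
  (\int[lambdaXi]_p (f1 (dot3 u p) * f2 (dot3 v p) * f3 (dot3 w p))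
   = (`|det3 u v w|^-1)%:E *
     (\int[mu]_x f1 x * (\int[mu]_x f2 x * \int[mu]_x f3 x)))%E.
Proof.
move=> D0 mf1 mf2 mf3 f10 f20 f30.
have [u30|] := eqVneq u.2 0; last by move=> u30; exact: ge0_integral_lin3_u3.
have [v30|v30] := eqVneq v.2 0.
  have w30 : w.2 != 0.
    by apply: contra D0 => /eqP w30; rewrite /det3 u30 v30 w30; apply/eqP; ring.
  have DE : det3 w v u = - det3 u v w by rewrite /det3; ring.
  under eq_integral do rewrite muleC (muleC (f1 _)) muleA.
  rewrite ge0_integral_lin3_u3 ?DE ?oppr_eq0 // normrN; congr (_ * _)%E.
  by rewrite muleC (muleC (\int[mu]_x f2 x)%E) muleA.
have DE : det3 v u w = - det3 u v w by rewrite /det3; ring.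
under eq_integral do rewrite (muleC (f1 _)).
rewrite ge0_integral_lin3_u3 ?DE ?oppr_eq0 // normrN; congr (_ * _)%E.
by rewrite muleCA.
Qed.

End linear_change_of_variables_space.

Section L2_norms.
Context {R : realType}.
Local Notation RR := (measurableTypeR R).

Lemma Lnorm2E d (T : measurableType d) (m : {measure set T -> \bar R}) (f : T -> R) :
  ('N[m]_(2%:E)[EFin \o f] = (\int[m]_x (f x ^+ 2)%:E) `^ 2^-1)%E.
Proof.
rewrite Lnorm.unlock /=; congr (_ `^ _)%E; apply: eq_integral => x _.
by rewrite powR_mulrn ?normr_ge0 // real_normK // num_real.
Qed.

Lemma Lnorm2_indic d (T : measurableType d) (m : {measure set T -> \bar R})
    (E : set T) :
  measurable E -> ('N[m]_(2%:E)[EFin \o \1_E] = (m E) `^ 2^-1)%E.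
Proof.
move=> mE; rewrite Lnorm2E -[in RHS](setIT E) -integral_indic //.
congr (_ `^ _)%E; apply: eq_integral => x _.
by rewrite indicE; case: (x \in E); rewrite ?expr1n ?expr0n.
Qed.

Lemma cauchy_schwarz_ge0 d (T : measurableType d)
    (m : {measure set T -> \bar R}) (f g : T -> R) :
  measurable_fun setT f -> measurable_fun setT g ->
  (forall x, 0 <= f x) -> (forall x, 0 <= g x) ->
  (\int[m]_x (f x * g x)%:E <=
   'N[m]_(2%:E)[EFin \o f] * 'N[m]_(2%:E)[EFin \o g])%E.
Proof.
move=> mf mg f0 g0.
have := hoelder m mf mg (ltr0Sn _ 1) (ltr0Sn _ 1) (ltac:(lra) : 2^-1 + 2^-1 = 1 :> R).
rewrite Lnorm1; apply: le_trans; rewrite le_eqVlt; apply/orP; left; apply/eqP.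
by apply: eq_integral => x _ /=; rewrite ger0_norm // mulr_ge0.
Qed.

Local Notation N h := ('N[@lebesgue_measure R]_(2%:E)[EFin \o h])%E.

Lemma Lnorm2_lin3 (h1 h2 h3 : R -> R) (u v w : R * R * R) :
  det3 u v w != 0 ->
  measurable_fun setT h1 -> measurable_fun setT h2 -> measurable_fun setT h3 ->
  ('N[lambdaXi]_(2%:E)[EFin \o (fun p : RR * RR * RR =>
     (h1 (dot3 u p) * h2 (dot3 v p) * h3 (dot3 w p))%R)]
   = (`|det3 u v w|^-1 `^ 2^-1)%:E * (N h1 * (N h2 * N h3)))%E.
Proof.
move=> D0 mh1 mh2 mh3.
pose sq (h : R -> R) x := ((h x ^+ 2)%:E : \bar R).
have msq h : measurable_fun setT h -> measurable_fun setT (sq h).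
  by move=> mh; apply/measurable_EFinP; exact: measurable_funX.
have sq0 h x : (0 <= sq h x)%E by rewrite lee_fin sqr_ge0.
rewrite !Lnorm2E.
under eq_integral => p _.
  rewrite (_ : _%:E = sq h1 (dot3 u p) * sq h2 (dot3 v p) * sq h3 (dot3 w p))%E;
    last by rewrite /sq !exprMn !EFinM.
  over.
rewrite ge0_integral_lin3 //; try exact: msq.
by rewrite !poweRM ?mule_ge0 ?integral_ge0 ?lee_fin ?invr_ge0 ?normr_ge0.
Qed.

End L2_norms.

Definition xi_coef {R : pzRingType} (n : 'I_4) : R * R * R :=
  match val n with
  | 0 => (1, 0, 0)
  | 1 => (0, 1, 0)
  | 2 => (0, 0, 1)
  | _ => (1, -1, 1)
  end.

Definition lfun_coef {R : pzRingType} (L : 'I_4 -> R) : R * R * R :=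
  (L 0 + L ord_max, L 1 - L ord_max, L 2 + L ord_max).

Section coordinates_on_Xi.
Context {R : realType}.

Lemma sum_ord4 (F : 'I_4 -> R) : \sum_(i < 4) F i = F 0 + F 1 + F 2 + F ord_max.
Proof.
rewrite !big_ord_recr big_ord0 /= add0r.
by congr (_ + _ + _ + _); congr F; apply: val_inj.
Qed.

Lemma xi_ofE (p : R * R * R) n : xi_of p n = dot3 (xi_coef n) p.
Proof. by case: n => -[|[|[|[|n]]]] i4; rewrite /xi_of /xi_coef /dot3 /=; ring. Qed.

Lemma lfun4_alt4_xi_of (p : R * R * R) : lfun4 alt4 (xi_of p) = 0.
Proof. by rewrite /lfun4 sum_ord4 /alt4 /xi_of /=; ring. Qed.

Lemma lfun4E (L xi : 'I_4 -> R) :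
  lfun4 L xi = dot3 (lfun_coef L) (xi 0, xi 1, xi 2) - L ord_max * lfun4 alt4 xi.
Proof. by rewrite /lfun4 !sum_ord4 /alt4 /dot3 /=; ring. Qed.

Lemma lfun4_xi_of (L : 'I_4 -> R) (p : R * R * R) :
  lfun4 L (xi_of p) = dot3 (lfun_coef L) p.
Proof. by rewrite lfun4E lfun4_alt4_xi_of mulr0 subr0; case: p => [[]]. Qed.

End coordinates_on_Xi.

Section independence.
Context {R : realType}.

Lemma lin_indep3_lfun_coef (L1 L2 : 'I_4 -> R) (k1 k2 : R) :
  lin_indep3 alt4 L1 L2 ->
  (forall p, k1 * dot3 (lfun_coef L1) p + k2 * dot3 (lfun_coef L2) p = 0) ->
  k1 = 0 /\ k2 = 0.
Proof.
move=> indep dep.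
have [xi|_ -> ->] // := indep (k1 * L1 ord_max + k2 * L2 ord_max) k1 k2.
rewrite (lfun4E L1) (lfun4E L2).
transitivity (k1 * dot3 (lfun_coef L1) (xi 0, xi 1, xi 2) +
              k2 * dot3 (lfun_coef L2) (xi 0, xi 1, xi 2)); first by ring.
exact: dep.
Qed.

Lemma minors_eq0_lin_dep (u v : R * R * R) :
  det3 (xi_coef 0) u v = 0 -> det3 (xi_coef 1) u v = 0 ->
  det3 (xi_coef 2) u v = 0 ->
  exists k1 k2 : R, (k1 != 0 \/ k2 != 0) /\
                    forall p, k1 * dot3 u p + k2 * dot3 v p = 0.
Proof.
case: u v => [[a1 b1] c1] [[a2 b2] c2] M0 M1 M2.
have [a20|a20] := eqVneq a2 0; last first.
  exists a2, (- a1); split; first by left.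
  move=> p; transitivity (det3 (xi_coef 1) (a1, b1, c1) (a2, b2, c2) * p.2 -
                          det3 (xi_coef 2) (a1, b1, c1) (a2, b2, c2) * p.1.2).
    by rewrite /dot3 /det3 /=; ring.
  by rewrite M1 M2; ring.
have [b20|b20] := eqVneq b2 0; last first.
  exists b2, (- b1); split; first by left.
  move=> p; transitivity (det3 (xi_coef 2) (a1, b1, c1) (a2, b2, c2) * p.1.1 -
                          det3 (xi_coef 0) (a1, b1, c1) (a2, b2, c2) * p.2).
    by rewrite /dot3 /det3 /=; ring.
  by rewrite M0 M2; ring.
have [c20|c20] := eqVneq c2 0; last first.
  exists c2, (- c1); split; first by left.
  move=> p; transitivity (det3 (xi_coef 0) (a1, b1, c1) (a2, b2, c2) * p.1.2 -
                          det3 (xi_coef 1) (a1, b1, c1) (a2, b2, c2) * p.1.1).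
    by rewrite /dot3 /det3 /=; ring.
  by rewrite M0 M1; ring.
exists 0, 1; split; first by right; exact: oner_neq0.
by move=> p; rewrite /dot3 /= a20 b20 c20; ring.
Qed.

Lemma lin_indep3_minor (L1 L2 : 'I_4 -> R) : lin_indep3 alt4 L1 L2 ->
  [\/ det3 (xi_coef 0) (lfun_coef L1) (lfun_coef L2) != 0,
      det3 (xi_coef 1) (lfun_coef L1) (lfun_coef L2) != 0 |
      det3 (xi_coef 2) (lfun_coef L1) (lfun_coef L2) != 0].
Proof.
move=> indep.
have [M0|] := eqVneq (det3 (xi_coef 0) (lfun_coef L1) (lfun_coef L2)) 0;
  last by move=> ?; apply: Or31.
have [M1|] := eqVneq (det3 (xi_coef 1) (lfun_coef L1) (lfun_coef L2)) 0;
  last by move=> ?; apply: Or32.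
have [M2|] := eqVneq (det3 (xi_coef 2) (lfun_coef L1) (lfun_coef L2)) 0;
  last by move=> ?; apply: Or33.
have [k1 [k2 [k_neq0 dep]]] := minors_eq0_lin_dep M0 M1 M2.
have [k10 k20] := lin_indep3_lfun_coef indep dep.
by move: k_neq0; rewrite k10 k20 eqxx; case.
Qed.

End independence.

Section splitting.
Context {R : realType}.
Local Notation mu := (@lebesgue_measure R).
Local Notation N h := ('N[mu]_(2%:E)[EFin \o h])%E.
Local Notation RR := (measurableTypeR R).

Lemma integral_Xi_split_le (L1 L2 : 'I_4 -> R) (i j k : 'I_4) :
  perm_eq (index_enum 'I_4) [:: i; j; ord_max; k] ->
  @det3 R (xi_coef i) (xi_coef j) (xi_coef ord_max) != 0 ->
  det3 (xi_coef k) (lfun_coef L1) (lfun_coef L2) != 0 ->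
  exists C : R,
  forall (g : 'I_4 -> R -> R) (E1 E2 : set R),
    (forall n, measurable_fun setT (g n)) ->
    (forall n x, 0 <= g n x) ->
    measurable E1 -> measurable E2 ->
    (\int[lambdaXi]_p
        ((\prod_(n < 4) g n (xi_of p n))
         * \1_E1 (lfun4 L1 (xi_of p)) * \1_E2 (lfun4 L2 (xi_of p)))%:E
     <= C%:E * (poweR (mu E1) 2^-1 * poweR (mu E2) 2^-1) * \prod_(n < 4) N (g n))%E.
Proof.
set D1 := det3 _ _ _; set D2 := det3 _ _ _ => ijk D10 D20.
exists (`|D1|^-1 `^ 2^-1 * `|D2|^-1 `^ 2^-1) => g E1 E2 mg g0 mE1 mE2.
pose G p := g i (dot3 (xi_coef i) p) * g j (dot3 (xi_coef j) p) *
            g ord_max (dot3 (xi_coef ord_max) p).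
pose H p := g k (dot3 (xi_coef k) p) *
            \1_E1 (dot3 (lfun_coef L1) p) * \1_E2 (dot3 (lfun_coef L2) p).
under eq_integral => p _.
  rewrite (perm_big _ ijk) /= !big_cons big_nil !xi_ofE !lfun4_xi_of.
  rewrite (_ : _ * _ = G p * H p); last by rewrite /G /H; ring.
  over.
have mdot u : measurable_fun setT (fun p : RR * RR * RR => g u (dot3 (xi_coef u) p)).
  exact: measurableT_comp (mg u) (measurable_dot3 _).
have mind (E : set R) (w : R * R * R) : measurable E ->
    measurable_fun setT (fun p : RR * RR * RR => \1_E (dot3 w p) : R).
  by move=> mE; exact: measurableT_comp (measurable_indic mE) (measurable_dot3 _).
have mG : measurable_fun [set: RR * RR * RR] G.
  by apply: measurable_funM; [apply: measurable_funM|]; exact: mdot.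
have mH : measurable_fun [set: RR * RR * RR] H.
  by apply: measurable_funM; [apply: measurable_funM|]; [exact: mdot|exact: mind..].
have G0 p : 0 <= G p by rewrite /G !mulr_ge0.
have H0 p : 0 <= H p by rewrite /H !mulr_ge0.
apply: le_trans (cauchy_schwarz_ge0 lambdaXi mG mH G0 H0) _.
rewrite Lnorm2_lin3 // Lnorm2_lin3 // ?Lnorm2_indic //.
rewrite (perm_big _ ijk) /= !big_cons big_nil mule1 EFinM.
by rewrite (AC ((1*(1*(1*1)))*(1*(1*(1*1)))) ((1*5)*(7*8)*(2*(3*(4*6))))).
Qed.

End splitting.

Lemma lin_indep3_split (R : realType) (L1 L2 : 'I_4 -> R) :
  lin_indep3 alt4 L1 L2 ->
  exists i j k : 'I_4,
    [/\ perm_eq (index_enum 'I_4) [:: i; j; ord_max; k],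
        @det3 R (xi_coef i) (xi_coef j) (xi_coef ord_max) != 0 &
        det3 (xi_coef k) (lfun_coef L1) (lfun_coef L2) != 0].
Proof.
have perm4 (s : seq 'I_4) :
    perm_eq (iota 0 4) (map val s) -> perm_eq (index_enum 'I_4) s.
  move=> s4; apply: (perm_map_inj val_inj).
  by rewrite [index_enum _]unlock -enumT val_enum_ord.
case/lin_indep3_minor => D; [exists 1, 2, 0 | exists 0, 2, 1 | exists 0, 1, 2];
  split => //; try exact: perm4; apply/eqP; rewrite /det3 /=; lra.
Qed.

Theorem lemma4p5 (R : realType) (L1 L2 : 'I_4 -> R) :
  lin_indep3 alt4 L1 L2 ->
  exists C : R,
  forall (g : 'I_4 -> R -> R) (E1 E2 : set R),
    (forall n, measurable_fun setT (g n)) ->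
    (forall n x, 0 <= g n x) ->
    (forall n, ('N[@lebesgue_measure R]_(2%:E)[EFin \o g n] < +oo)%E) ->
    measurable E1 -> measurable E2 ->
    (\int[lambdaXi]_p
        ((\prod_(n < 4) g n (xi_of p n))
         * \1_E1 (lfun4 L1 (xi_of p)) * \1_E2 (lfun4 L2 (xi_of p)))%:E
     <= C%:E
        * (poweR (@lebesgue_measure R E1) 2^-1
           * poweR (@lebesgue_measure R E2) 2^-1)
        * \prod_(n < 4) 'N[@lebesgue_measure R]_(2%:E)[EFin \o g n])%E.
Proof.
move=> /lin_indep3_split[i [j [k [ijk Dijk DkL]]]].
have [C HC] := integral_Xi_split_le ijk Dijk DkL.
by exists C => g E1 E2 mg g0 _; exact: HC.
Qed.
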